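(* Let $G=(V,E)$ be a finite connected graph with vertices $v_1,\dots,v_n$, $n=|V|$, and distance matrix $D=(d(v_i,v_j))_{i,j=1}^n$. Suppose $w\in\mathbb{R}^n$ satisfies $Dw=n\cdot\mathbf{1}$ and $K=\min_i w_i>0$. Then $$\lambda_1(G)\ge \frac{\|w\|_{\ell^1}}{2n^2}\ge \frac{K}{2n}.$$
   Context: Graphs are finite, simple, undirected and unweighted; $d(u,v)$ is the shortest-path (combinatorial) distance, $\mathbf{1}\in\mathbb{R}^n$ is the all-ones vector, and $\|w\|_{\ell^1}=\sum_i|w_i|$. The quantity $\lambda_1(G)$ is the smallest nontrivial eigenvalue of the graph Laplacian (degree matrix minus adjacency matrix), i.e. $$\lambda_1(G)=\inf\left\{\frac{\sum_{(u,v)\in E}(f(u)-f(v))^2}{\sum_{v\in V}f(v)^2}: f:V\to\mathbb{R},\ f\not\equiv 0,\ \sum_{v\in V}f(v)=0\right\},$$ where each undirected edge is counted once. (The equation $Dw=n\cdot\mathbf{1}$ forces $n\ge 2$.) *)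

(* Defs.v *)
From mathcomp Require Import all_boot all_order all_algebra.
From mathcomp Require Import classical_sets reals.

Set Implicit Arguments.
Unset Strict Implicit.
Unset Printing Implicit Defensive.

Import Order.TTheory GRing.Theory Num.Theory.

Local Open Scope ring_scope.
Local Open Scope classical_set_scope.

(** A finite simple graph is a symmetric irreflexive [e : rel V] on a finite
    type [V]. *)

(** Length of a shortest [e]-path from [x] to [y]. Only lengths below [#|V|]
    are searched, which is enough for connected vertices (see [gdistP]); the
    value is [#|V|] when [y] is not reachable from [x]. *)
Definition gdist (V : finType) (e : rel V) (x y : V) : nat :=
  \big[minn/#|V|]_(k < #|V| |
      [exists p : k.-tuple V, path e x p && (last x p == y)]) (k : nat).

Lemma gdistP (V : finType) (e : rel V) (x y : V) : connect e x y ->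
  (exists p : seq V, [/\ path e x p, last x p = y & size p = gdist e x y]) /\
  (forall p : seq V, path e x p -> last x p = y -> (gdist e x y <= size p)%N).
Proof.
have short (p : seq V) : path e x p -> last x p = y -> exists q : seq V,
  [/\ path e x q, last x q = y, (size q <= size p)%N & (size q < #|V|)%N].
  move=> ep <-; case/shortenP: ep => q eq uq /uniq_leq_size sqp.
  exists q; split=> //; first by apply: sqp; case/andP: uq.
  by rewrite -[(size q).+1]/(size (x :: q)) -(card_uniqP uq) max_card.
have le (q : seq V) : path e x q -> last x q = y -> (size q < #|V|)%N ->
    (gdist e x y <= size q)%N.
  move=> eq lq sq.
  rewrite /gdist -minEnat -leEnat; apply: (bigmin_le_cond _ (j := Ordinal sq)).
  by apply/existsP; exists (in_tuple q); rewrite eq lq eqxx.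
move=> /connectP[p ep /esym lp]; split; last first.
  by move=> q eq lq; have [r [er lr sr /(le _ er lr)/leq_trans->]] := short _ eq lq.
have [q [eq lq _ sq]] := short _ ep lp.
have: (gdist e x y < #|V|)%N by apply: leq_ltn_trans (le _ eq lq sq) sq.
rewrite /gdist; elim/big_ind: _ => [|a b IHa IHb|k]; first by rewrite ltnn.
  by rewrite /minn; case: ifP.
by case/existsP=> r /andP[er /eqP lr] _; exists r; rewrite size_tuple.
Qed.

Definition distance_mx (R : realType) (V : finType) (e : rel V) (n : nat)
    (v : 'I_n -> V) : 'M[R]_n :=
  \matrix_(i, j) (gdist e (v i) (v j))%:R.

Definition l1norm (R : realType) (n : nat) (w : 'cV[R]_n) : R :=
  \sum_(i < n) `|w i 0|.

(** The condition on ranks keeps one of the two orientations of each edge, so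
    every undirected edge is counted once. *)
Definition dirichlet (R : realType) (V : finType) (e : rel V) (f : V -> R) : R :=
  \sum_(p : V * V | e p.1 p.2 && (enum_rank p.1 < enum_rank p.2)%N)
    (f p.1 - f p.2) ^+ 2.

(** Smallest nontrivial Laplacian eigenvalue, in its variational form. For
    [#|V| <= 1] the set is empty and the value is the junk [0]. *)
Definition lambda1 (R : realType) (V : finType) (e : rel V) : R :=
  inf [set dirichlet e f / (\sum_x f x ^+ 2)
      | f in [set f : V -> R | (exists x, f x != 0) /\ \sum_x f x = 0]].

(* Main.v *)
Require Import Defs.
From mathcomp Require Import all_boot all_order all_algebra.
From mathcomp Require Import classical_sets reals.
From mathcomp Require Import ring lra.

Import Order.TTheory GRing.Theory Num.Theory.

Local Open Scope ring_scope.

(** The equation [Dw = n 1] says that, seen from any vertex [x], the weighted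
    total distance [\sum_y d(x, y) w_y] is the same number [n]. Let [f] have
    mean zero. Since the mean minimizes the quadratic deviation,
    [\sum_x f(x)^2 <= \sum_x (f(x) - f(y))^2] for every [y]; averaging this over
    [y] with the weights [w] gives
      [(\sum_y w_y) \sum_x f(x)^2 <= \sum_x \sum_y w_y (f(x) - f(y))^2].
    By Cauchy-Schwarz along a shortest path from [x] to [y], which visits no
    vertex twice, [(f(x) - f(y))^2 <= d(x, y) S], where [S] is the sum of
    [(f(a) - f(b))^2] over all ordered pairs of adjacent vertices, that is,
    twice the Dirichlet energy ([gdist_dirichlet]). The equation on [w] then
    bounds the double sum: each of the [n] values of [x] contributes at most
    [n S]. This is the Poincare inequality
      [(\sum_y w_y) \sum_x f(x)^2 <= 2 n^2 dirichlet(f)]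
    ([equilibrium_poincare]), which is the lower bound on the eigenvalue. The
    comparison with [K / (2 n)] is just [\sum_y w_y >= n K]. *)

Section Energy.
Set Implicit Arguments.
Unset Strict Implicit.
Variables (R : realType) (V : finType) (e : rel V).

(** Cauchy-Schwarz for the telescoping sum of the increments along a path;
    [zip (x :: p) p] lists the steps of the path. *)
Lemma path_sqr_increment (f : V -> R) (x : V) (p : seq V) :
  (f x - f (last x p)) ^+ 2 <=
  (size p)%:R * \sum_(q <- zip (x :: p) p) (f q.1 - f q.2) ^+ 2.
Proof.
elim: p x => [|y p IH] x; first by rewrite subrr expr0n mul0r.
have := IH y; rewrite [zip (x :: _) _]/= big_cons.
set S := \sum_(_ <- _) _.
have S_ge0 : 0 <= S by apply: sumr_ge0 => q _; apply: sqr_ge0.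
have -> : f x - f (last x (y :: p)) = (f x - f y) + (f y - f (last y p)).
  by rewrite addrA subrK.
rewrite -[size (y :: p)]/((size p).+1) -[(size p).+1%:R]natr1 /=.
move: (f x - f y) (f y - f _) => a b.
have [->|p_neq0] := posnP (size p).
  rewrite mul0r add0r mul1r => b2_le0.
  have /eqP -> : b == 0 by rewrite -sqrf_eq0 eq_le b2_le0 sqr_ge0.
  by rewrite addr0 lerDl.
have k_gt0 : (0 : R) < (size p)%:R by rewrite ltr0n.
move: (size p)%:R k_gt0 => k k_gt0 b2_le.
(* AM-GM with weight k: k (k a^2 + S - 2 a b) >= (k a - b)^2 *)
have : 0 <= k * (k * a ^+ 2 + S - 2 * a * b).
  have := sqr_ge0 (k * a - b); nra.
rewrite pmulr_rge0 //; nra.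
Qed.

(** The steps of a path without repeated vertices are pairwise distinct, so
    they form a subfamily of the oriented edges. *)
Lemma path_energy_le (f : V -> R) (x : V) (p : seq V) :
  path e x p -> uniq p ->
  \sum_(q <- zip (x :: p) p) (f q.1 - f q.2) ^+ 2 <=
  \sum_(q : V * V | e q.1 q.2) (f q.1 - f q.2) ^+ 2.
Proof.
move=> ep up; have uzip : uniq (zip (x :: p) p).
  by apply: (@map_uniq _ _ snd); rewrite -/unzip2 unzip2_zip.
have ezip q : q \in zip (x :: p) p -> e q.1 q.2.
  elim: p x ep {up uzip} => [|y p IH] x //= /andP[exy ep].
  by rewrite inE => /predU1P[->|/(IH _ ep)].
rewrite big_uniq //= big_mkcond [leRHS]big_mkcond /=.
apply: ler_sum => q _; case: ifP => [/ezip -> //|_].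
by case: ifP => // _; apply: sqr_ge0.
Qed.

Lemma sum_oriented_edges (e_sym : symmetric e) (e_irr : irreflexive e)
    (f : V -> R) :
  \sum_(q : V * V | e q.1 q.2) (f q.1 - f q.2) ^+ 2 = 2 * dirichlet e f.
Proof.
rewrite mulr_natl mulr2n.
rewrite (bigID (fun q : V * V => enum_rank q.1 < enum_rank q.2)%N) /=.
have swap_inj : injective (fun q : V * V => (q.2, q.1)).
  by move=> [a b] [c d] [-> ->].
congr (_ + _); rewrite (reindex_inj swap_inj) /=.
rewrite /dirichlet; apply: eq_big => [[a b]|[a b] _] /=; last first.
  by rewrite -sqrrN opprB.
rewrite e_sym; have [eab|//] := boolP (e a b).
rewrite -leqNgt leq_eqVlt; case: eqP => //= /ord_inj/enum_rank_inj ab.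
by move: eab; rewrite ab e_irr.
Qed.

Lemma gdist_dirichlet (e_sym : symmetric e) (e_irr : irreflexive e)
    (f : V -> R) (x y : V) : connect e x y ->
  (f x - f y) ^+ 2 <= (gdist e x y)%:R * (2 * dirichlet e f).
Proof.
move=> /gdistP[[p [ep <- <-]] _]; case/shortenP: ep => q eq uq /uniq_leq_size sqp.
have {}sqp : (size q <= size p)%N by apply: sqp; case/andP: uq.
rewrite -sum_oriented_edges //; apply: le_trans (path_sqr_increment f x q) _.
apply: ler_pM; rewrite ?ler0n ?ler_nat //.
  by apply: sumr_ge0 => *; apply: sqr_ge0.
by apply: path_energy_le => //; case/andP: uq.
Qed.

Lemma sum_sqr_centered (f : V -> R) (c : R) : \sum_x f x = 0 ->
  \sum_x f x ^+ 2 <= \sum_x (f x - c) ^+ 2.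
Proof.
move=> f0.
have -> : \sum_x (f x - c) ^+ 2 = \sum_x f x ^+ 2 + \sum_(x : V) c ^+ 2.
  transitivity (\sum_x (f x ^+ 2 + c ^+ 2 + f x * (- 2 * c))).
    by apply: eq_bigr => x _; ring.
  by rewrite !big_split /= -[X in _ + X = _]mulr_suml f0 mul0r addr0.
by rewrite lerDl; apply: sumr_ge0 => x _; apply: sqr_ge0.
Qed.

(** Replacing the mean of [f] by the value [f y] only increases the quadratic
    deviation, so the choice of [y] is free; drawing it from [u] turns the
    distances produced by [gdist_dirichlet] into the constant [c]. *)
Lemma equilibrium_poincare (e_sym : symmetric e) (e_irr : irreflexive e)
    (e_conn : forall x y : V, connect e x y) (u : V -> R) (c : R)
    (u_ge0 : forall y, 0 <= u y)
    (u_eq : forall x, \sum_y (gdist e x y)%:R * u y = c)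
    (f : V -> R) : \sum_x f x = 0 ->
  (\sum_y u y) * (\sum_x f x ^+ 2) <= 2 * (#|V|%:R * c) * dirichlet e f.
Proof.
move=> f0.
apply: (@le_trans _ _ (\sum_y \sum_x u y * (f x - f y) ^+ 2)).
  rewrite mulr_suml; apply: ler_sum => y _; rewrite -mulr_sumr.
  by rewrite ler_wpM2l // sum_sqr_centered.
rewrite exchange_big /=.
have -> : 2 * (#|V|%:R * c) * dirichlet e f =
    \sum_(x : V) c * (2 * dirichlet e f).
  by rewrite sumr_const -[RHS]mulr_natl; ring.
apply: ler_sum => x _; rewrite -(u_eq x) mulr_suml; apply: ler_sum => y _.
by rewrite [leRHS]mulrAC mulrC ler_wpM2r // gdist_dirichlet.
Qed.

Lemma lambda1_ge (x y : V) (a : R) : x != y ->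
  (forall f : V -> R, \sum_z f z = 0 ->
     a * (\sum_z f z ^+ 2) <= dirichlet e f) ->
  a <= lambda1 R e.
Proof.
move=> xy a_le; apply: lb_le_inf.
  (* the infimum of the empty set is a junk value; two distinct vertices give
     an admissible function *)
  pose f z : R := (z == x)%:R - (z == y)%:R.
  exists (dirichlet e f / (\sum_z f z ^+ 2)), f => //; split.
    by exists x; rewrite /f eqxx (negbTE xy) subr0 oner_eq0.
  have sum_delta t : \sum_z (z == t)%:R = 1 :> R.
    by rewrite (bigD1 t) //= eqxx big1 ?addr0 // => z /negbTE ->.
  by rewrite /f big_split /= sumrN !sum_delta subrr.
move=> _ [f [[z fz] f0] <-].
rewrite ler_pdivlMr ?a_le // (bigD1 z) //=.
apply: ltr_wpDr; last by rewrite lt0r sqrf_eq0 fz sqr_ge0.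
by apply: sumr_ge0 => t _; apply: sqr_ge0.
Qed.

End Energy.

Lemma gdistxx (V : finType) (e : rel V) (x : V) : gdist e x x = 0%N.
Proof.
have [_ /(_ [::] isT erefl)] := gdistP (connect0 e x).
by rewrite leqn0 => /eqP.
Qed.

Theorem theorem3 (R : realType) (V : finType) (e : rel V)
  (e_sym : symmetric e) (e_irr : irreflexive e)
  (e_conn : forall x y : V, connect e x y)
  (n : nat) (v : 'I_n -> V) (v_bij : bijective v)
  (w : 'cV[R]_n) (Dw : distance_mx R e v *m w = n%:R *: const_mx 1)
  (K : R) (K_min : (exists i, w i 0 = K) /\ (forall i, K <= w i 0))
  (K_gt0 : 0 < K) :
  lambda1 R e >= l1norm w / (2 * n%:R ^+ 2) /\
  l1norm w / (2 * n%:R ^+ 2) >= K / (2 * n%:R).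
Proof.
have [[i0 _] K_le] := K_min.
have w_gt0 i : 0 < w i 0 := lt_le_trans K_gt0 (K_le i).
have n_gt0 : (0 : R) < n%:R by rewrite ltr0n (leq_ltn_trans _ (ltn_ord i0)).
have l1E : l1norm w = \sum_i w i 0.
  by apply: eq_bigr => i _; rewrite gtr0_norm.
have row_eq i : \sum_j (gdist e (v i) (v j))%:R * w j 0 = n%:R.
  have /matrixP/(_ i 0) := Dw; rewrite !mxE mulr1 => <-.
  by apply: eq_bigr => j _; rewrite mxE.
split; last first.
  have nK : n%:R * K <= l1norm w.
    rewrite l1E -[n in n%:R]card_ord mulr_natl -sumr_const.
    exact: ler_sum.
  rewrite ler_pdivlMr ?mulr_gt0 ?exprn_gt0 //.
  apply: le_trans nK; rewrite le_eqVlt; apply/orP; left; apply/eqP.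
  by field; rewrite gt_eqF.
have [v' vK v'K] := v_bij; have v_on := onW_bij xpredT v_bij.
have card_V : #|V| = n by rewrite -(bij_eq_card v_bij) card_ord.
(* on a single vertex the distance matrix vanishes, against n > 0 *)
have [j vj] : exists j, v i0 != v j.
  apply/existsP; apply: contraTT isT => /existsPn single.
  have := row_eq i0; rewrite big1 => [/esym/eqP|j _]; first by rewrite gt_eqF.
  by have /negPn/eqP <- := single j; rewrite gdistxx mul0r.
apply: (lambda1_ge vj) => f f0.
have -> : l1norm w = \sum_y w (v' y) 0.
  by rewrite l1E (reindex v v_on) /=; apply: eq_bigr => i _; rewrite vK.
have u_ge0 y : 0 <= w (v' y) 0 by apply: ltW.
have u_eq x : \sum_y (gdist e x y)%:R * w (v' y) 0 = n%:R.
  rewrite -(row_eq (v' x)) v'K (reindex v v_on) /=.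
  by apply: eq_bigr => i _; rewrite vK.
have := equilibrium_poincare e_sym e_irr e_conn u_ge0 u_eq f0.
rewrite card_V => poincare.
rewrite mulrAC ler_pdivrMr ?mulr_gt0 ?exprn_gt0 //.
by rewrite [leRHS]mulrC expr2.
Qed.
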